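(* Let $(G,\sigma)$ be a signed graph. For every edge $e\in E(G)$ we have $$\psi(G,\sigma)-2\le\psi(G-e,\sigma)\le\psi(G,\sigma)+2,$$ where $(G-e,\sigma)$ denotes $G-e$ with the restriction of $\sigma$. Furthermore, both bounds can be attained; in particular, for every integer $k\ge5$ there exist a signed graph $(G,\sigma)$ with $\psi(G,\sigma)=k$ and an edge $e$ with $\psi(G-e,\sigma)=k-2$, and for every integer $k\ge6$ there exist a signed graph $(G,\sigma)$ with $\psi(G,\sigma)=k$ and an edge $e$ with $\psi(G-e,\sigma)=k+2$.
   Context: A signed graph $(G,\sigma)$ is a finite simple graph $G$ with a signature $\sigma:E(G)\to\{-,+\}$; subgraphs inherit the signature. Switching a set $S\subseteq V(G)$ changes the sign of every edge with exactly one end in $S$; two signed graphs on the same underlying graph are equivalent if one is obtained from the other by switching some set of vertices. For $k\ge1$ let $M_k=\{-n,\dots,-1,+1,\dots,+n\}$ if $k=2n$, and $M_k=\{-n,\dots,-1,\pm0,+1,\dots,+n\}$ if $k=2n+1$, where $\pm0$ is a single colour with $-(\pm0)=\pm0$. A $k$-colouring of $(G,\sigma)$ is a map $\phi:V(G)\to M_k$. Let $K_k^*$ be the signed multigraph with vertex set $\{i\ge 0: +i\in M_k\}$ (vertex $0$ standing for colour $\pm0$ when $k$ is odd), in which every two distinct vertices are joined by exactly one positive and one negative edge, and every vertex $i\neq0$ carries exactly one negative loop. Given a $k$-colouring $\phi$, the reduced signed graph $R(G,\sigma,\phi)$ is obtained by (1) switching every vertex with a negative colour $-i$ and recolouring it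 $+i$; (2) identifying, for each $i$, all vertices of colour $+i$ (resp. $\pm0$) into a single vertex $i$ (resp. $0$), edges inside a class becoming loops; (3) keeping at most one positive and at most one negative edge (or loop) between any two vertices (or at any vertex). The colouring $\phi$ is complete if $R(G,\sigma,\phi)$ is exactly $K_k^*$. The achromatic number $\psi(G,\sigma)$ is the largest $k\ge1$ such that some signed graph equivalent to $(G,\sigma)$ admits a complete $k$-colouring. *)

(* Defs.v *)
From HB Require Import structures.
From mathcomp Require Import all_boot all_order all_algebra.
From mathcomp Require Import boolp.
Set Implicit Arguments.
Unset Strict Implicit.
Unset Printing Implicit Defensive.
Import Order.TTheory GRing.Theory Num.Theory.

Definition sign := bool.
Definition pos : sign := true.
Definition neg : sign := false.

Record graph (V : finType) := Graph {
  edges : {set {set V}};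
  card_edge : forall e : {set V}, e \in edges -> #|e| = 2 }.

Lemma card_edge_del (V : finType) (G : graph V) (e0 e : {set V}) :
  e \in edges G :\ e0 -> #|e| = 2.
Proof. by move=> /setD1P[_]; apply: card_edge. Qed.

Definition delete_edge (V : finType) (G : graph V) (e : {set V}) : graph V :=
  Graph (@card_edge_del V G e).

(* Only the values on [edges G] are ever used, so the restriction of a         *)
(* signature of [G] to [delete_edge G e] is the same function.                 *)
Definition signature (V : finType) := {set V} -> sign.

Definition switch (V : finType) (S : {set V}) (s : signature V) : signature V :=
  fun e => if #|e :&: S| == 1 then ~~ s e else s e.

Definition equivalent (V : finType) (G : graph V) (s t : signature V) : Prop :=
  exists S : {set V}, forall e, e \in edges G -> t e = switch S s e.

(* The colours +i, -i and +-0 are the integers i, -i and 0. *)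
Definition colours (k : nat) : pred int :=
  fun c => (absz c <= k./2) && (odd k || (c != 0%R)).

(* Signed multigraphs with vertices in [nat] and with at most one edge of each *)
(* sign between two vertices: [medge x i j] tells whether there is an edge of  *)
(* sign [x] between [i] and [j], a loop if [i = j].                            *)
Record smultigraph := SMultigraph {
  mvertex : pred nat;
  medge : sign -> rel nat }.

Definition same_smultigraph (H K : smultigraph) : Prop :=
  (forall i, mvertex H i = mvertex K i) /\
  (forall x i j, medge H x i j = medge K x i j).

Definition Kstar (k : nat) : smultigraph :=
  let vert i := colours k (Posz i) in
  SMultigraph vert
    (fun x i j => [&& vert i, vert j &
                      if i == j then (x == neg) && (i != 0) else true]).

Definition reduced (V : finType) (G : graph V) (s : signature V)
    (phi : V -> int) : smultigraph :=
  let t := switch [set v | (phi v < 0)%R] s in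
  let col v := absz (phi v) in
  SMultigraph
    (fun i => [exists v, col v == i])
    (fun x i j => [exists u, exists v,
       [&& [set u; v] \in edges G, t [set u; v] == x, col u == i & col v == j]]).

Definition complete_colouring (V : finType) (G : graph V) (s : signature V)
    (k : nat) (phi : V -> int) : Prop :=
  (forall v, colours k (phi v)) /\
  same_smultigraph (reduced G s phi) (Kstar k).

Definition completely_colourable (V : finType) (G : graph V) (s : signature V)
    (k : nat) : Prop :=
  exists2 t, equivalent G s t & exists phi, complete_colouring G t k phi.

(* [completely_colourable_bound] below shows that the bound [2 * #|V|] on [k]  *)
(* is harmless. The value is 0 when [V] is empty.                              *)
Definition achromatic (V : finType) (G : graph V) (s : signature V) : nat :=
  \max_(k < (2 * #|V|).+1 | (0 < k) && `[< completely_colourable G s k >]) k.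

Lemma completely_colourable_bound (V : finType) (G : graph V) (s : signature V)
    (k : nat) :
  completely_colourable G s k -> k <= 2 * #|V|.
Proof.
move=> [t _ [phi [_ [vert _]]]].
have ex_v (i : 'I_(k./2)) : exists v, absz (phi v) == i.+1.
  apply/existsP; have /= -> := vert i.+1.
  by rewrite /colours /= orbT andbT ltn_ord.
pose f i : V := xchoose (ex_v i).
have fP i : absz (phi (f i)) = i.+1 by apply/eqP/(xchooseP (ex_v i)).
have f_inj : injective f.
  by move=> i j eq_f; apply/val_inj/eq_add_S; rewrite -!fP eq_f.
rewrite -(odd_double_half k) -mul2n; case: (boolP (odd k)) => [odd_k | _]; last first.
  by rewrite add0n leq_mul2l -[k./2]card_ord (leq_card _ f_inj).
have /existsP[v0 /eqP v0P] : [exists v, absz (phi v) == 0].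
  by have /= -> := vert 0; rewrite /colours /= odd_k.
pose g (o : option 'I_(k./2)) := if o is Some i then f i else v0.
have g_inj : injective g.
  move=> [i|] [j|] //= eq_g; first by rewrite (f_inj _ _ eq_g).
    by have := fP i; rewrite eq_g v0P.
  by have := fP j; rewrite -eq_g v0P.
have := leq_card _ g_inj; rewrite card_option card_ord => lt_k.
apply: (@leq_trans (2 * (k./2).+1)); last by rewrite leq_mul2l.
by rewrite mulnS leq_add2r.
Qed.

Lemma leq_achromatic (V : finType) (G : graph V) (s : signature V) (k : nat) :
  0 < k -> completely_colourable G s k -> k <= achromatic G s.
Proof.
move=> k_gt0 col_k; have le_k := completely_colourable_bound col_k.
rewrite -ltnS in le_k.
apply: (@leq_bigmax_cond _ _ (fun i : 'I_(2 * #|V|).+1 => nat_of_ord i)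
  (Ordinal le_k)).
by rewrite /= k_gt0; apply/asboolP.
Qed.

Lemma achromatic_colourable (V : finType) (G : graph V) (s : signature V) :
  0 < achromatic G s -> completely_colourable G s (achromatic G s).
Proof.
rewrite /achromatic.
pose P := [pred k : 'I_(2 * #|V|).+1 | (0 < k) && `[< completely_colourable G s k >]].
rewrite (eq_bigl (mem P)) //.
case: (pickP P) => [k0 Pk0 _ | P0]; last by rewrite big_pred0.
have P_gt0 : 0 < #|P| by apply/card_gt0P; exists k0.
have [k /andP[_ /asboolP Pk] ->] :=
  eq_bigmax_cond (fun i : 'I_(2 * #|V|).+1 => nat_of_ord i) P_gt0.
exact: Pk.
Qed.

(* Main.v *)
Require Import Defs.
From HB Require Import structures.
From mathcomp Require Import all_boot all_order all_algebra.
From mathcomp Require Import zify.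
From mathcomp Require Import boolp.

Set Implicit Arguments.
Unset Strict Implicit.
Unset Printing Implicit Defensive.

(** The achromatic number is monotone under induced subgraphs: keep a complete
    colouring of the subgraph and extend it to the other vertices, using as few
    new colours, and then as few edgeless new classes, as possible.  Two classes
    not joined by both signs could be merged after a switching, and of two
    edgeless classes one could absorb a vertex of the other, so the extension is
    complete with at most one edgeless class, which becomes the class of 0.
    Discarding a class that contains an end of [e] costs at most two colours and
    leaves a subgraph that does not see [e]; both inequalities follow.

    For sharpness, let [T] be a vertex cover of [n] vertices.  Each nonzero class
    contains a vertex of [T].  If [a, b] in [T] have the same neighbours outside
    [T] and all these edges, and [ab], are negative, then [a] and [b] cannot be
    the only vertices of [T] in two distinct classes: all edges between these
    classes would have the same sign.  This rules out [2n] or more colours; if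
    two further vertices of [T] have at most two neighbours outside [T], it also
    rules out [2n - 1].  Adding a positive edge outside [T], or deleting an edge
    from [a] to a vertex outside [T], destroys the obstruction and gains two
    colours. *)

(** * Complete colourings as a switching together with vertex classes *)

Definition adj (V : finType) (G : graph V) : rel V :=
  fun u v => [set u; v] \in edges G.

(** The sign of [uv] after switching [R]. *)
Definition sgn (V : finType) (s : signature V) (R : pred V) (u v : V) : sign :=
  s [set u; v] (+) (R u (+) R v).

(* Normal form of a complete colouring, restricted to [W]: the vertices of
   negative colour have been switched together with the set [R] making the two
   signatures equivalent, so that only the classes remain; [o] stands for 0. *)
Definition complete_on (V : finType) (K : eqType) (o : K) (W : pred V)
    (G : graph V) (s : signature V) (R : pred V) (c : V -> K) : Prop :=
  [/\ forall u v, W u -> W v -> adj G u v -> c u = c v ->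
        c u <> o /\ sgn s R u v = neg,
      forall v, W v -> c v <> o ->
        exists u u', [/\ W u, W u', adj G u u', c u = c v & c u' = c v]
    & forall v w x, W v -> W w -> c v <> c w ->
        exists u u', [/\ W u, W u', adj G u u' &
                         [/\ c u = c v, c u' = c w & sgn s R u u' = x]]].

Lemma adjC (V : finType) (G : graph V) u v : adj G u v = adj G v u.
Proof. by rewrite /adj setUC. Qed.

Lemma adj_neq (V : finType) (G : graph V) u v : adj G u v -> u != v.
Proof.
move=> /card_edge uv2; apply/eqP => eq_uv.
by move: uv2; rewrite eq_uv setUid cards1.
Qed.

Lemma sgnC (V : finType) (s : signature V) R u v : sgn s R u v = sgn s R v u.
Proof. by rewrite /sgn setUC (addbC (R u)). Qed.

Lemma switch_set2 (V : finType) (S : {set V}) (s : signature V) (u v : V) :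
  u != v -> switch S s [set u; v] = s [set u; v] (+) ((u \in S) (+) (v \in S)).
Proof.
move=> neq_uv; rewrite /switch setIUl cardsU setIACA setIid.
have ->: [set u] :&: [set v] = set0.
  by apply/setP => w; rewrite !inE; case: eqP => // ->; apply/negbTE.
rewrite set0I cards0 subn0.
have card1 w : #|[set w] :&: S| = (w \in S).
  case: (boolP (w \in S)) => [Sw|nSw].
    by rewrite (setIidPl _) ?cards1 // sub1set.
  apply/eqP; rewrite cards_eq0 setI_eq0; apply/pred0P => x /=; rewrite inE.
  by case: eqP => //= ->; apply/negbTE.
by rewrite !card1; case: (u \in S) (v \in S) (s _) => [] [] [].
Qed.

(** The switching to an equivalent signature and that of the negatively coloured vertices compose
    into one, [R]. Conversely, once [R] is switched, all colours can be taken nonnegative and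
    nothing remains to be switched. *)
Lemma completely_colourable_natP (V : finType) (G : graph V) (s : signature V) k :
  completely_colourable G s k <->
  exists R (d : V -> nat), complete_on 0 predT G s R d /\
    forall i, [exists v, d v == i] = colours k (Posz i).
Proof.
split=> [[t [S eqt] [phi [phi_col [vert edge]]]] | [R [d [[prop loop cross] vert]]]].
  pose R v := (v \in S) (+) (phi v < 0)%R.
  have sgnE u v : adj G u v ->
      switch [set v | (phi v < 0)%R] t [set u; v] = sgn s R u v.
    move=> uv; have neq_uv := adj_neq uv.
    rewrite switch_set2 // eqt // switch_set2 // !inE /sgn /R.
    by case: (s _) (u \in S) (v \in S) (phi u < 0)%R (phi v < 0)%R => [] [] [] [] [].
  have col_vert v : colours k (Posz (absz (phi v))).
    by have /= <- := vert (absz (phi v)); apply/existsP; exists v.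
  exists R, (fun v => absz (phi v)); split=> //.
  split=> [u v _ _ uv eq_uv | v _ v0 | v w x _ _ neq_vw].
  - have : medge (reduced G t phi) (sgn s R u v) (absz (phi u)) (absz (phi v)).
      apply/existsP; exists u; apply/existsP; exists v.
      by rewrite -/(adj G u v) uv sgnE // !eqxx.
    by rewrite edge /= eq_uv eqxx => /and3P[_ _ /andP[/eqP-> /eqP]].
  - have : medge (Kstar k) neg (absz (phi v)) (absz (phi v)).
      by rewrite /= col_vert eqxx; apply/eqP.
    rewrite -edge => /existsP[u /existsP[u' /and4P[uu' _ /eqP cu /eqP cu']]].
    by exists u, u'.
  have : medge (Kstar k) x (absz (phi v)) (absz (phi w)).
    by rewrite /= !col_vert; case: eqP.
  rewrite -edge => /existsP[u /existsP[u' /and4P[uu' /eqP tx /eqP cu /eqP cu']]].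
  by exists u, u'; split=> //; split=> //; rewrite -tx sgnE.
exists (switch [set v | R v] s); first by exists [set v | R v].
have dcol v : colours k (Posz (d v)) by rewrite -vert; apply/existsP; exists v.
exists (fun v => Posz (d v)); split=> //; split=> // x i j.
have sgnE u v : adj G u v ->
    switch [set v | (Posz (d v) < 0)%R] (switch [set v | R v] s) [set u; v]
    = sgn s R u v.
  move=> uv; have neq_uv := adj_neq uv.
  by rewrite !switch_set2 // !inE /= addbF.
apply/existsP/and3P => /=.
  move=> [u /existsP[v /and4P[uv /eqP sx /eqP<- /eqP<-]]]; split=> //.
  rewrite sgnE // in sx; case: eqP => // eq_uv.
  by have [/eqP-> <-] := prop u v isT isT uv eq_uv; rewrite sx eqxx.
case; rewrite -!vert => /existsP[v /eqP dv] /existsP[w /eqP dw].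
case: eqP => [eq_ij /andP[/eqP-> i0] | neq_ij _].
  have dv0 : d v <> 0 by rewrite dv; apply/eqP.
  have [u [u' [_ _ uu' du du']]] := loop v isT dv0.
  exists u; apply/existsP; exists u'; rewrite -/(adj G u u') uu' sgnE //.
  have [_ ->] := prop u u' isT isT uu' (etrans du (esym du')).
  by rewrite du du' -eq_ij dv !eqxx.
have [|u [u' [_ _ uu' [du du' sx]]]] := cross v w x isT isT; first by rewrite dv dw.
exists u; apply/existsP; exists u'; rewrite -/(adj G u u') uu' sgnE // sx.
by rewrite du du' dv dw !eqxx.
Qed.

Definition used (V K : finType) (o : K) (W : pred V) (c : V -> K) : {set K} :=
  [set x | (x != o) && [exists v, W v && (c v == x)]].

(** A nonzero class stands for the two colours [+i] and [-i], the class [o] for one. *)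
Definition ncolours (V K : finType) (o : K) (W : pred V) (c : V -> K) : nat :=
  2 * #|used o W c| + [exists v, W v && (c v == o)].

(** Nonzero classes are numbered from 1 by their place in an enumeration and [o] becomes 0; the
    parity of [ncolours] records whether 0 occurs. *)
Lemma complete_colourable (V K : finType) (o : K) (G : graph V) (s : signature V)
    (R : pred V) (c : V -> K) :
  complete_on o predT G s R c -> completely_colourable G s (ncolours o predT c).
Proof.
move=> [prop loop cross]; apply: (iffRL (completely_colourable_natP G s _)).
set A := used o predT c.
have inA v : c v != o -> c v \in enum A.
  by move=> cv; rewrite mem_enum inE cv; apply/existsP; exists v => /=.
pose d v := if c v == o then 0 else (index (c v) (enum A)).+1.
have d_inj u v : d u = d v -> c u = c v.
  rewrite /d; case: (eqVneq (c u) o) => [->|cu]; case: (eqVneq (c v) o) => // cv.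
  by move=> /succn_inj /index_inj-> //; apply: inA.
have dE u v : c u = c v -> d u = d v by rewrite /d => ->.
have d0 v : d v <> 0 <-> c v <> o.
  by rewrite /d; case: eqP => ncv; split.
exists R, d; split.
  split=> [u v _ _ uv /d_inj eq_uv | v _ /d0 v0 | v w x _ _ neq_vw].
  - by have [/d0] := prop u v isT isT uv eq_uv.
  - by have [u [u' [_ _ uu' /dE cu /dE cu']]] := loop v isT v0; exists u, u'.
  have [|u [u' [_ _ uu' [/dE cu /dE cu' sx]]]] := cross v w x isT isT.
    by move/dE.
  by exists u, u'.
have half_k : (ncolours o predT c)./2 = #|A|.
  by rewrite /ncolours addnC mul2n half_bit_double.
have odd_k : odd (ncolours o predT c) = [exists v, c v == o].
  by rewrite /ncolours mul2n oddD odd_double; case: [exists v, _].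
move=> i; rewrite /colours /= half_k odd_k.
apply/existsP/andP => [[v /eqP<-] | [le_i]].
  rewrite /d; case: (eqVneq (c v) o) => [cv|cv] /=.
    by rewrite leq0n orbF; split=> //; apply/existsP; exists v; apply/eqP.
  by rewrite orbT cardE index_mem inA.
case: i le_i => [_ | i lt_i _].
  by rewrite orbF => /existsP[v cv]; exists v; rewrite /d cv.
have lt_i' : i < size (enum A) by rewrite -cardE.
have [x0 _] : exists x : K, x \in A by apply/card_gt0P; exact: leq_ltn_trans lt_i.
have : nth x0 (enum A) i \in A by rewrite -mem_enum mem_nth.
rewrite inE => /andP[xo /existsP[v /eqP cv]]; exists v.
by rewrite /d cv (negbTE xo) index_uniq // enum_uniq.
Qed.

Lemma colourable_complete (V : finType) (G : graph V) (s : signature V) k :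
  completely_colourable G s k ->
  exists R (c : V -> 'I_(k./2).+1),
    complete_on ord0 predT G s R c /\
    forall i, [exists v, c v == i] = odd k || (i != ord0).
Proof.
move=> /completely_colourable_natP[R [d [[prop loop cross] vert]]].
have d_le v : d v < (k./2).+1.
  have : colours k (Posz (d v)) by rewrite -vert; apply/existsP; exists v.
  by case/andP.
pose c v : 'I_(k./2).+1 := Ordinal (d_le v).
have cE u v : c u = c v <-> d u = d v by split=> [[]//|eq_d]; apply: val_inj.
have c0 v : c v <> ord0 <-> d v <> 0.
  by split=> nv eqv; apply: nv; [apply: val_inj | case: eqv].
exists R, c; split; last first.
  move=> i; have := vert i; rewrite /colours /= -ltnS ltn_ord /= => <-.
  by apply: eq_existsb => v.
split=> [u v _ _ uv /cE eq_uv | v _ /c0 v0 | v w x _ _ neq_vw].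
- by rewrite c0; apply: prop.
- have [u [u' [_ _ uu' /cE cu /cE cu']]] := loop v isT v0; by exists u, u'.
have [|u [u' [_ _ uu' [/cE cu /cE cu' sx]]]] := cross v w x isT isT.
  by move/cE.
by exists u, u'.
Qed.

(** * Extending a complete colouring from an induced subgraph *)

(* [inl x] is a colour of the given partial colouring, [inr y] a new one. *)
Definition extends (V K : finType) (o : K) (W : pred V) (G : graph V)
    (s : signature V) (R0 : pred V) (c0 : V -> K) (R : pred V) (f : V -> K + V) :=
  [/\ forall v, W v -> c0 v <> o -> f v = inl (c0 v) /\ R v = R0 v,
      forall v x, f v = inl x -> x \in used o W c0
    & forall u v, adj G u v -> f u = f v -> sgn s R u v = neg].

Definition occurs (V K : finType) (f : V -> K + V) (y : V) : bool :=
  [exists v, f v == inr y].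

Definition has_edge (V K : finType) (G : graph V) (f : V -> K + V) (y : V) : bool :=
  [exists u, exists v, [&& adj G u v, f u == inr y & f v == inr y]].

(* Counting edgeless classes twice makes both the merging of two classes and the
   removal of an edgeless class decrease the cost. *)
Definition weight (V K : finType) (G : graph V) (f : V -> K + V) (y : V) : nat :=
  occurs f y + (occurs f y && ~~ has_edge G f y).

Definition cost (V K : finType) (G : graph V) (f : V -> K + V) : nat :=
  \sum_y weight G f y.

Lemma weight_le (V K : finType) (G : graph V) (f g : V -> K + V) y :
  (occurs g y -> occurs f y) -> (has_edge G f y -> has_edge G g y) ->
  weight G g y <= weight G f y.
Proof.
rewrite /weight; case: (occurs g y) => [-> // | _ _]; last by [].
by case: (has_edge G f y) (has_edge G g y) => [] [] // H; have := H isT.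
Qed.

Lemma cost_lt (V K : finType) (G : graph V) (f g : V -> K + V) y :
  weight G g y < weight G f y ->
  (forall z, z != y -> weight G g z <= weight G f z) -> cost G g < cost G f.
Proof.
move=> lt_y le_z; rewrite /cost (bigD1 y) // [X in _ < X](bigD1 y) //=.
by rewrite -addSn leq_add // leq_sum.
Qed.

(** Edges between the two classes all have the sign opposite to [x]; switching the class of [y] if
    they are positive makes the union proper. Only a new class is switched, so frozen vertices are
    untouched. *)
Lemma merge_colours (V K : finType) (o : K) W (G : graph V) s R0 (c0 : V -> K) R f
    (p : K + V) (y : V) (x : sign) :
  extends o W G s R0 c0 R f -> p <> inr y -> (exists v, f v = p) -> occurs f y ->
  (forall u v, adj G u v -> f u = p -> f v = inr y -> sgn s R u v <> x) ->
  exists R' f', extends o W G s R0 c0 R' f' /\ cost G f' < cost G f.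
Proof.
move=> [frozen old proper] py [v0 fv0] occ_y nox.
pose f' v := if f v == inr y then p else f v.
pose R' v := R v (+) ((f v == inr y) && (x == neg)).
exists R', f'; split.
  split.
  - move=> v Wv cv; have [fv Rv] := frozen v Wv cv.
    by rewrite /f' /R' fv /= addbF.
  - move=> v z; rewrite /f'; case: eqP => _; last exact: old.
    by rewrite -fv0; exact: old.
  move=> u v uv.
  have sgnE : sgn s R' u v = sgn s R u v (+)
      (((f u == inr y) (+) (f v == inr y)) && (x == neg)).
    rewrite /sgn /R'.
    by case: (s _) (R u) (R v) (f u == _) (f v == _) (x == neg) => [] [] [] [] [] [].
  rewrite sgnE /f'; case: (f u =P _) => fu; case: (f v =P _) => fv /= eq_uv.
  - by rewrite addbF proper // fu fv.
  - rewrite adjC in uv; have := nox v u uv (esym eq_uv) fu.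
    by rewrite sgnC; case: (sgn s R u v) (x) => [] [].
  - by have := nox u v uv eq_uv fv; case: (sgn s R u v) (x) => [] [].
  by rewrite addbF proper.
apply: (@cost_lt _ _ _ _ _ y) => [|z zy].
  have -> : weight G f' y = 0.
    rewrite /weight (_ : occurs f' y = false) //; apply/existsP => -[v].
    by rewrite /f'; case: (f v =P _) => [_|fv] /eqP.
  by rewrite /weight occ_y.
apply: weight_le => [/existsP[v] | /existsP[u /existsP[v /and3P[uv /eqP fu /eqP fv]]]].
  rewrite /f'; case: (f v =P _) => [_ /eqP pz | _ fv]; apply/existsP.
    by exists v0; rewrite fv0 pz.
  by exists v.
have neq_zy : inr z == inr y :> K + V = false by apply/negbTE.
apply/existsP; exists u; apply/existsP; exists v.
by rewrite uv /f' fu fv neq_zy eqxx.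
Qed.

(* A star is a tree, so it can be switched to be all negative: moving one end
   of a cross edge into the other edgeless class is always proper. *)
Lemma join_edgeless (V K : finType) (o : K) W (G : graph V) s R0 (c0 : V -> K) R f
    (x y u v : V) :
  extends o W G s R0 c0 R f -> x <> y -> ~~ has_edge G f x -> ~~ has_edge G f y ->
  adj G u v -> f u = inr x -> f v = inr y ->
  exists R' f', extends o W G s R0 c0 R' f' /\ cost G f' < cost G f.
Proof.
move=> [frozen old proper] xy /existsPn ex ey uv fu fv.
pose f' w := if w == v then inr x else f w.
(* Flipping the vertices of class [x] joined positively to [v] makes this star negative; class [x]
   has no inner edge that could be spoiled. *)
pose R' w := R w (+) [&& f w == inr x, adj G v w & sgn s R v w].
have neq_yx : inr y == inr x :> K + V = false by apply/negbTE/eqP; case=> /esym.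
have star b : adj G v b -> f b = inr x -> sgn s R' v b = neg.
  move=> vb fb; rewrite /sgn /R' fv fb neq_yx eqxx vb /= /sgn.
  by case: (s _) (R v) (R b) => [] [] [].
exists R', f'; split.
  split.
  - move=> w Ww cw; have [fw Rw] := frozen w Ww cw.
    rewrite /f' /R' fw /= addbF; case: eqP => // wv.
    by move: fw; rewrite wv fv.
  - by move=> w z; rewrite /f'; case: eqP => // _; exact: old.
  move=> a b ab; have neq_ab := adj_neq ab.
  rewrite /f'; case: (a =P v) => av; case: (b =P v) => bv eq_ab.
  - by rewrite av bv eqxx in neq_ab.
  - by subst a; apply: star.
  - by subst b; rewrite sgnC; apply: star; rewrite // adjC.
  case: (f a =P inr x) => fa.
    have /existsPn/(_ b) := ex a; rewrite ab fa -eq_ab fa eqxx.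
    by [].
  rewrite -(proper a b) // /sgn /R' -eq_ab.
  by rewrite (negbTE (introN eqP fa)) /= !addbF.
have nxv : u != v by apply: adj_neq uv.
have occ z : occurs f' z -> occurs f z || (z == x).
  move=> /existsP[w]; rewrite /f'; case: (w =P v) => [_ /eqP[->] | _ fw].
    by rewrite eqxx orbT.
  by apply/orP; left; apply/existsP; exists w.
(* Class [x] gains the edge [uv] and drops from weight 2 to 1, while the edgeless class [y] cannot
   gain weight by losing [v]. *)
apply: (@cost_lt _ _ _ _ _ x) => [|z zx].
  have -> : weight G f x = 2.
    rewrite /weight (_ : occurs f x) /=; last by apply/existsP; exists u; apply/eqP.
    by rewrite (_ : has_edge G f x = false) //; apply/negbTE/existsPn.
  suff ex' : has_edge G f' x by rewrite /weight ex' andbF addn0 ltnS leq_b1.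
  apply/existsP; exists u; apply/existsP; exists v.
  by rewrite uv /f' eqxx (negbTE nxv) fu eqxx.
apply: weight_le => [/occ | ez]; first by rewrite (negbTE zx) orbF.
have zy : z != y by apply/eqP => zy; move: ey; rewrite -zy ez.
have /existsP[a /existsP[b /and3P[ab /eqP fa /eqP fb]]] := ez.
have nv w : f w = inr z -> w == v = false.
  move=> fw; apply/eqP => wv; move: zy; rewrite wv fv in fw.
  by case: fw => ->; rewrite eqxx.
by apply/existsP; exists a; apply/existsP; exists b; rewrite ab /f' !nv // fa fb eqxx.
Qed.

(** At least cost no merging is possible, which gives both signs between two classes of which one is
    new. Distinct edgeless classes would then be joined by an edge, and one could absorb an end of
    it at lower cost. *)
Lemma cheapest_extension (V K : finType) (o : K) W (G : graph V) s R0 (c0 : V -> K) :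
  complete_on o W G s R0 c0 ->
  exists R f, [/\ extends o W G s R0 c0 R f,
    forall v w x, f v <> f w -> exists u u',
      [/\ adj G u u', f u = f v, f u' = f w & sgn s R u u' = x]
   & forall x y, occurs f x -> occurs f y ->
      ~~ has_edge G f x -> ~~ has_edge G f y -> x = y].
Proof.
move=> [prop0 loop0 cross0].
(* The zero class is released: its vertices, like those outside [W], start as new singleton
   classes. *)
pose f0 v : K + V := if W v && (c0 v != o) then inl (c0 v) else inr v.
have : exists R f, extends o W G s R0 c0 R f.
  exists R0, f0; split.
  - by move=> v Wv /eqP cv; rewrite /f0 Wv cv.
  - move=> v x; rewrite /f0; case: ifP => // /andP[Wv cv] [<-].
    by rewrite inE cv; apply/existsP; exists v; rewrite Wv /=.
  move=> u v uv; rewrite /f0; case: ifP => [/andP[Wu cu]|_]; last first.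
    by case: ifP => // _ [eq_uv]; have := adj_neq uv; rewrite eq_uv eqxx.
  by case: ifP => // /andP[Wv cv] [eq_uv]; have [] := prop0 u v Wu Wv uv eq_uv.
case=> R [f]; have [N] := ubnP (cost G f); elim: N R f => // N IH R f ltN ext.
have [frozen old proper] := ext.
have [[R' [f' [ext' lt']]] | noreduce] :=
  EM (exists R' f', extends o W G s R0 c0 R' f' /\ cost G f' < cost G f).
  by apply: (IH R' f') => //; apply: leq_trans lt' _.
have new_cross v y x : f v <> inr y -> occurs f y ->
    exists u u', [/\ adj G u u', f u = f v, f u' = inr y & sgn s R u u' = x].
  move=> fvy occ_y; have [//|no] := EM (exists u u',
    [/\ adj G u u', f u = f v, f u' = inr y & sgn s R u u' = x]).
  case: noreduce; apply: (merge_colours ext fvy (ex_intro _ v erefl) occ_y (x := x)).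
  by move=> u u' uu' fu fu' sx; apply: no; exists u, u'.
have cross v w x : f v <> f w -> exists u u',
      [/\ adj G u u', f u = f v, f u' = f w & sgn s R u u' = x].
  move=> neq; case fw: (f w) neq => [q|y] neq; last first.
    by apply: new_cross => //; apply/existsP; exists w; apply/eqP.
  case fv: (f v) neq => [p|y] neq; last first.
    have [||u [u' [uu' fu fu' sx]]] := new_cross w y x.
    - by rewrite fw.
    - by apply/existsP; exists v; apply/eqP.
    by exists u', u; rewrite adjC sgnC -fw.
  (* Between two old classes the edge provided by [c0] survives, the colours and switching of its
     ends being frozen. *)
  have := old v p fv; rewrite inE => /andP[/eqP po /existsP[v' /andP[Wv' /eqP cv']]].
  have := old w q fw; rewrite inE => /andP[/eqP qo /existsP[w' /andP[Ww' /eqP cw']]].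
  have [|u [u' [Wu Wu' uu' [cu cu' sx]]]] := cross0 v' w' x Wv' Ww'.
    by rewrite cv' cw' => pq; apply: neq; rewrite pq.
  rewrite cv' in cu; rewrite cw' in cu'.
  have [|fu Ru] := frozen u Wu; first by rewrite cu.
  have [|fu' Ru'] := frozen u' Wu'; first by rewrite cu'.
  by exists u, u'; rewrite fu fu' cu cu' /sgn Ru Ru'.
exists R, f; split=> // x y /existsP[v /eqP fv] /existsP[w /eqP fw] ex ey.
have [//|/eqP xy] := eqVneq x y.
have [|u [u' [uu' fu fu' _]]] := cross v w pos; first by rewrite fv fw; case.
rewrite fv in fu; rewrite fw in fu'.
by case: noreduce; exact: join_edgeless ext xy ex ey uu' fu fu'.
Qed.

(** Releasing the zero class may cost one colour. An edgeless class can take its place; failing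
    that, if there is no new class, the old zero class is restored; otherwise some new class has a
    loop and brings two colours. *)
Lemma extend_complete (V K : finType) (o : K) W (G : graph V) s R0 (c0 : V -> K) :
  complete_on o W G s R0 c0 ->
  exists2 k, completely_colourable G s k & ncolours o W c0 <= k.
Proof.
move=> comp0; have [prop0 loop0 cross0] := comp0.
have [R [f [[frozen old proper] cross edgeless_uniq]]] := cheapest_extension comp0.
have old_o v : f v <> inl o.
  by move=> /old; rewrite inE eqxx.
have old_loop v x : f v = inl x ->
    exists u u', [/\ adj G u u', f u = f v & f u' = f v].
  move=> fv; have := old v x fv.
  rewrite inE => /andP[/eqP xo /existsP[v' /andP[Wv' /eqP cv']]].
  have [|u [u' [Wu Wu' uu' cu cu']]] := loop0 v' Wv'; first by rewrite cv'.
  rewrite cv' in cu cu'; exists u, u'.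
  have [|-> _] := frozen u Wu; first by rewrite cu.
  have [|-> _] := frozen u' Wu'; first by rewrite cu'.
  by rewrite fv cu cu'.
have [[y0 /andP[occ0 ne0]] | noedgeless] :=
  EM (exists y, occurs f y && ~~ has_edge G f y).
(* The name [inl o] is free, since [used] excludes [o]. *)
- pose c v : K + V := if f v == inr y0 then inl o else f v.
  have cE u v : c u = c v -> f u = f v.
    rewrite /c; case: (f u =P _) => fu; case: (f v =P _) => fv //.
    - by rewrite fu fv.
    - by move/esym/old_o.
    by move/old_o.
  have fE u v : f u = f v -> c u = c v by rewrite /c => ->.
  have comp : complete_on (inl o) predT G s R c.
    split=> [u v _ _ uv /cE eq_uv | v _ | v w x _ _ neq].
    + split; last exact: proper.
      rewrite /c; case: eqP => [fu _ | _ /old_o //]; case/negP: ne0.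
      apply/existsP; exists u; apply/existsP; exists v.
      by rewrite uv -eq_uv fu eqxx.
    + rewrite /c; case: eqP => // nfv _; case fv: (f v) nfv => [x|y] nfv.
        have [u [u' [uu' fu fu']]] := old_loop v x fv.
        by exists u, u'; rewrite fu fu' fv.
      have occ_y : occurs f y by apply/existsP; exists v; apply/eqP.
      have [/existsP[u /existsP[u' /and3P[uu' /eqP fu /eqP fu']]] | ney] :=
        boolP (has_edge G f y).
        exists u, u'; rewrite fu fu' /=; split=> //; by case: eqP.
      by case: nfv; rewrite (edgeless_uniq y y0).
    have [|u [u' [uu' fu fu' sx]]] := cross v w x; first by move/fE.
    by exists u, u'; split=> //; split=> //; apply: fE.
  exists (ncolours (inl o) predT c); first exact: complete_colourable comp.
  rewrite /ncolours leq_add //.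
    rewrite leq_mul2l /= -(card_imset _ (@inl_inj K V)); apply: subset_leq_card.
    apply/subsetP => _ /imsetP[x + ->]; rewrite !inE.
    move=> /andP[xo /existsP[v /andP[Wv /eqP cv]]].
    apply/andP; split=> //; apply/existsP; exists v => /=.
    have [|fv _] := frozen v Wv; first by rewrite cv; apply/eqP.
    by rewrite /c fv cv.
  have -> : [exists v, predT v && (c v == inl o)].
    by have /existsP[v fv] := occ0; apply/existsP; exists v; rewrite /c fv eqxx.
  exact: leq_b1.
have new_loop v y : f v = inr y -> exists u u', [/\ adj G u u', f u = f v & f u' = f v].
  move=> fv; have [/existsP[u /existsP[u' /and3P[uu' /eqP fu /eqP fu']]] | ney] :=
    boolP (has_edge G f y).
    by exists u, u'; rewrite fu fu' fv.
  case: noedgeless; exists y; rewrite ney andbT.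
  by apply/existsP; exists v; apply/eqP.
have [/andP[/existsP[z0 /andP[Wz0 /eqP cz0]] nonew] | newORnozero] :=
  boolP ([exists v, W v && (c0 v == o)] && ~~ [exists y, occurs f y]).
(* All vertices lie in old classes; returning the zero class of [c0] to [o], with its switching
   [R0], takes no frozen vertex away. *)
- pose c v : K := if W v && (c0 v == o) then o else if f v is inl x then x else o.
  have isold v : exists x, f v = inl x.
    case fv: (f v) => [x|y]; first by exists x.
    by case/existsPn/(_ y)/negP: nonew; apply/existsP; exists v; apply/eqP.
  pose R' v := if W v && (c0 v == o) then R0 v else R v.
  have c_o v : c v = o -> W v /\ c0 v = o.
    rewrite /c; case: ifP => [/andP[-> /eqP]// | _].
    by have [x fv] := isold v; rewrite fv => xo; case: (old_o v); rewrite fv xo.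
  have c_old v : c v <> o -> f v = inl (c v) /\ R' v = R v.
    by rewrite /c /R'; case: ifP => // _; have [x ->] := isold v.
  have c_frozen v : W v -> c v = c0 v /\ R' v = R0 v.
    move=> Wv; rewrite /c /R' Wv /=; case: (c0 v =P o) => [-> //|cv].
    by have [-> ->] := frozen v Wv cv.
  have c_used v : exists v', W v' /\ c0 v' = c v.
    have [-> | /eqP cv] := eqVneq (c v) o; first by exists z0.
    have [fv _] := c_old v cv; have := old v _ fv.
    by rewrite inE => /andP[_ /existsP[v' /andP[Wv' /eqP cv']]]; exists v'.
  have comp : complete_on o predT G s R' c.
    split=> [u v _ _ uv eq_uv | v _ cv | v w x _ _ neq].
    + have [cu | /eqP cu] := eqVneq (c u) o.
        have [Wu cu0] := c_o u cu; have [Wv cv0] : W v /\ c0 v = o.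
          by apply: c_o; rewrite -eq_uv.
        by have [] := prop0 u v Wu Wv uv (etrans cu0 (esym cv0)).
      have cv : c v <> o by rewrite -eq_uv.
      have [fu Ru] := c_old u cu; have [fv Rv] := c_old v cv.
      split=> //; rewrite -(proper u v uv); last by rewrite fu fv eq_uv.
      by rewrite /sgn Ru Rv.
    + have [v' [Wv' cv']] := c_used v.
      have [|u [u' [Wu Wu' uu' cu cu']]] := loop0 v' Wv'; first by rewrite cv'.
      have [eu _] := c_frozen u Wu; have [eu' _] := c_frozen u' Wu'.
      by exists u, u'; rewrite eu eu' cu cu' cv'.
    have [v' [Wv' cv']] := c_used v; have [w' [Ww' cw']] := c_used w.
    have [|u [u' [Wu Wu' uu' [cu cu' sx]]]] := cross0 v' w' x Wv' Ww'.
      by rewrite cv' cw'.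
    have [eu Ru] := c_frozen u Wu; have [eu' Ru'] := c_frozen u' Wu'.
    by exists u, u'; rewrite eu eu' cu cu' cv' cw' /sgn Ru Ru'.
  exists (ncolours o predT c); first exact: complete_colourable comp.
  rewrite /ncolours leq_add //.
    rewrite leq_mul2l /=; apply: subset_leq_card; apply/subsetP => x.
    rewrite !inE => /andP[-> /existsP[v /andP[Wv /eqP cv]]].
    by apply/existsP; exists v => /=; have [-> _] := c_frozen v Wv; apply/eqP.
  have -> : [exists v, predT v && (c v == o)].
    by apply/existsP; exists z0; rewrite /c Wz0 cz0 !eqxx.
  exact: leq_b1.
have comp : complete_on (inl o) predT G s R f.
  split=> [u v _ _ uv eq_uv | v _ _ | v w x _ _ neq].
  + by split; [exact: old_o | exact: proper].
  + case fv: (f v) => [x|y].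
      have [u [u' [uu' fu fu']]] := old_loop v x fv.
      by exists u, u'; rewrite fu fu' fv.
    have [u [u' [uu' fu fu']]] := new_loop v y fv.
    by exists u, u'; rewrite fu fu' fv.
  have [u [u' [uu' fu fu' sx]]] := cross v w x neq; by exists u, u'.
exists (ncolours (inl o) predT f); first exact: complete_colourable comp.
have sub : inl @: used o W c0 \subset used (inl o) predT f.
  apply/subsetP => _ /imsetP[x + ->]; rewrite !inE.
  move=> /andP[xo /existsP[v /andP[Wv /eqP cv]]].
  apply/andP; split=> //; apply/existsP; exists v => /=.
  have [|fv _] := frozen v Wv; first by rewrite cv; apply/eqP.
  by rewrite fv cv.
have := subset_leq_card sub; rewrite (card_imset _ (@inl_inj K V)) => le_used.
have [hasz | noz] := boolP [exists v, W v && (c0 v == o)]; last first.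
  rewrite /ncolours (negbTE noz) addn0; apply: leq_trans (leq_addr _ _).
  by rewrite leq_mul2l.
(* A new class outweighs the lost 0: two colours against one. *)
move: newORnozero; rewrite hasz /= negbK => /existsP[y /existsP[v /eqP fv]].
have : inl @: used o W c0 \proper used (inl o) predT f.
  apply/properP; split=> //; exists (inr y).
    by rewrite inE /=; apply/existsP; exists v; rewrite fv /=.
  by apply/imsetP => -[].
move/proper_card; rewrite (card_imset _ (@inl_inj K V)) => lt_used.
rewrite /ncolours hasz; apply: leq_trans (leq_addr _ _).
apply: (@leq_trans (2 * (#|used o W c0|).+1)); last by rewrite leq_mul2l.
by rewrite mulnS addnC leq_add2r.
Qed.

(** * Deleting or adding an edge: the two inequalities *)

Lemma card_nonzero n : #|[set x : 'I_n.+1 | x != ord0]| = n.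
Proof.
rewrite (_ : [set x | _] = [set~ ord0]) ?cardsC1 ?card_ord //.
by apply/setP => x; rewrite !inE.
Qed.

(** Without the class [i] of an end of [pq], both graphs agree on the rest [W], whose colouring
    extends to [G']. The hypothesis is symmetric in the graphs, so it serves deletion and addition
    alike. *)
Lemma colourable_off_edge (V : finType) (G G' : graph V) (s : signature V) (p q : V) k :
  (forall u v, [set u; v] <> [set p; q] -> adj G u v = adj G' u v) ->
  completely_colourable G s k ->
  exists2 k', completely_colourable G' s k' & k - 2 <= k'.
Proof.
move=> eqG /colourable_complete[R [c [[prop loop cross] used_c]]].
pose i := if c p != ord0 then c p else c q.
pose W v := c v != i.
have WG u v : W u -> W v -> adj G u v = adj G' u v.
  move=> Wu Wv; apply: eqG => uvpq.
  have /set2P inp : p \in [set u; v] by rewrite uvpq set21.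
  have /set2P inq : q \in [set u; v] by rewrite uvpq set22.
  have : W p by case: inp => ->.
  have : W q by case: inq => ->.
  by rewrite /W /i; case: ifP; rewrite eqxx.
have Wc u v : W v -> c u = c v -> W u by rewrite /W => + ->.
have comp : complete_on ord0 W G' s R c.
  split=> [u v Wu Wv uv | v Wv cv | v w x Wv Ww neq].
  - by rewrite -WG // in uv; apply: prop.
  - have [u [u' [_ _ uu' cu cu']]] := loop v isT cv.
    have Wu := Wc u v Wv cu; have Wu' := Wc u' v Wv cu'.
    by exists u, u'; rewrite -WG.
  have [u [u' [_ _ uu' [cu cu' sx]]]] := cross v w x isT isT neq.
  have Wu := Wc u v Wv cu; have Wu' := Wc u' w Ww cu'.
  by exists u, u'; rewrite -WG.
have [k' col le_k'] := extend_complete comp; exists k' => //.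
apply: leq_trans le_k'; rewrite /ncolours.
have usedE x : x != i -> [exists v, W v && (c v == x)] = odd k || (x != ord0).
  move=> xi; rewrite -used_c; apply: eq_existsb => v.
  by case: (c v =P x) => [cv|]; rewrite ?andbF // andbT /W cv.
have kE := odd_double_half k.
(* Dropping the zero class loses at most one colour, dropping any other exactly two. *)
have [i0 | i0] := eqVneq i ord0.
  have -> : used ord0 W c = [set x | x != ord0].
    apply/setP => x; rewrite !inE; case: (eqVneq x ord0) => //= x0.
    by rewrite usedE ?i0 // x0 orbT.
  by rewrite card_nonzero; lia.
rewrite usedE 1?eq_sym // eqxx orbF.
have -> : used ord0 W c = [set x | x != ord0] :\ i.
  apply/setP => x; rewrite !inE [RHS]andbC; case: (eqVneq x ord0) => //= x0.
  have [-> | xi] := eqVneq x i; last by rewrite usedE // x0 orbT.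
  by apply/negbTE/existsPn => v; rewrite /W andNb.
have := cardsD1 i [set x : 'I_(k./2).+1 | x != ord0].
by rewrite card_nonzero inE i0 add1n => /(congr1 predn) /= <-; lia.
Qed.

Lemma achromatic_off_edge (V : finType) (G G' : graph V) (s : signature V) (p q : V) :
  (forall u v, [set u; v] <> [set p; q] -> adj G u v = adj G' u v) ->
  achromatic G s <= achromatic G' s + 2.
Proof.
(* Above 2, the colouring obtained has a positive number of colours, as [leq_achromatic]
   requires. *)
move=> eqG; rewrite addnC -leq_subLR; have [le2 | lt2] := leqP (achromatic G s) 2.
  by move: le2; rewrite -subn_eq0 => /eqP->.
have [|k' col le_k'] :=
  colourable_off_edge eqG (achromatic_colourable (G := G) (s := s) _).
  by apply: leq_trans lt2.
apply: leq_trans (le_k') (leq_achromatic _ col).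
by apply: leq_trans le_k'; rewrite subn_gt0.
Qed.

Lemma achromatic_delete_edge (V : finType) (G : graph V) (s : signature V) e :
  e \in edges G ->
  achromatic G s - 2 <= achromatic (delete_edge G e) s <= achromatic G s + 2.
Proof.
move=> eG; have /eqP/cards2P[p [q [_ eE]]] := card_edge eG.
have eq_adj u v : [set u; v] <> [set p; q] -> adj G u v = adj (delete_edge G e) u v.
  by move=> neq; rewrite /adj /= in_setD1 eE; case: eqP.
rewrite leq_subLR addnC (achromatic_off_edge _ eq_adj) /=.
exact: (achromatic_off_edge _ (fun u v neq => esym (eq_adj u v neq))).
Qed.

(** * Upper bounds from vertex covers and negative twins *)

Definition vertex_cover (V : finType) (G : graph V) (T : {set V}) : Prop :=
  forall u v, adj G u v -> (u \in T) || (v \in T).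

Definition negative_twins (V : finType) (G : graph V) (s : signature V)
    (T : {set V}) (a b : V) : Prop :=
  [/\ adj G a b -> s [set a; b] = neg,
      forall v, v \notin T -> adj G a v = adj G b v
    & forall v, v \notin T -> adj G a v -> s [set a; v] = neg /\ s [set b; v] = neg].

Definition few_outside (V : finType) (G : graph V) (T : {set V}) (p : V) : Prop :=
  exists y1 y2, forall v, v \notin T -> adj G p v -> v = y1 \/ v = y2.

Lemma cover_meets_class (V : finType) (K : eqType) (o : K) (G : graph V) s R c T v :
  complete_on o predT G s R c -> vertex_cover G T -> c v <> o ->
  exists2 t, t \in T & c t = c v.
Proof.
move=> [_ loop _] cov cv; have [u [u' [_ _ uu' cu cu']]] := loop v isT cv.
by have /orP[] := cov u u' uu'; [exists u | exists u'].
Qed.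

(** A neighbour of [a] outside [T] in the class of [a] is switched like [a], their edge being
    negative before and after; likewise for [b]. An edge between the classes is thus [ab], or joins
    one twin to an outside vertex that is tied to the other, and its sign is always
    [R a (+) R b]. *)
Lemma separated_twins (V : finType) (K : eqType) (o : K) (G : graph V) s R
    (c : V -> K) (T : {set V}) (a b : V) :
  complete_on o predT G s R c -> vertex_cover G T -> negative_twins G s T a b ->
  c a <> c b -> (forall t, t \in T -> c t = c a -> t = a) ->
  (forall t, t \in T -> c t = c b -> t = b) -> False.
Proof.
move=> [prop _ cross] cov [ab_neg ab_adj ab_out] neq a_only b_only.
have tied_a v : v \notin T -> adj G a v -> c v = c a -> R v = R a.
  move=> vT av cv; have [_] := prop a v isT isT av (esym cv).
  by rewrite /sgn; have [-> _] := ab_out v vT av; case: (R a) (R v) => [] [].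
have tied_b v : v \notin T -> adj G b v -> c v = c b -> R v = R b.
  move=> vT bv cv; have [_] := prop b v isT isT bv (esym cv).
  rewrite -ab_adj // in bv.
  by rewrite /sgn; have [_ ->] := ab_out v vT bv; case: (R b) (R v) => [] [].
have [u [u' [_ _ uu' [cu cu']]]] := cross a b (~~ (R a (+) R b)) isT isT neq.
suff -> : sgn s R u u' = R a (+) R b by case: (_ (+) _).
rewrite /sgn; have [uT | uT] := boolP (u \in T).
  have ua := a_only u uT cu; subst u.
  have [u'T | u'T] := boolP (u' \in T).
    by have u'b := b_only u' u'T cu'; subst u'; rewrite ab_neg.
  have [-> _] := ab_out u' u'T uu'; rewrite ab_adj // in uu'.
  by rewrite (tied_b u').
have := cov u u' uu'; rewrite (negbTE uT) /= => u'T.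
have u'b := b_only u' u'T cu'; subst u'; rewrite adjC -ab_adj // in uu'.
by have [_] := ab_out u uT uu'; rewrite setUC => ->; rewrite (tied_a u).
Qed.

Lemma injective_twins (V : finType) (K : eqType) (o : K) (G : graph V) s R
    (c : V -> K) (T : {set V}) (a b : V) :
  complete_on o predT G s R c -> vertex_cover G T -> negative_twins G s T a b ->
  a \in T -> b \in T -> a != b -> {in T &, injective c} -> False.
Proof.
move=> comp cov twins aT bT ab c_inj; apply: (separated_twins comp cov twins).
- by move/(c_inj a b aT bT)/eqP; apply/negP.
- by move=> t tT /(c_inj t a tT aT).
by move=> t tT /(c_inj t b tT bT).
Qed.

Lemma cover_image (V : finType) k (G : graph V) s R (c : V -> 'I_(k./2).+1) T :
  complete_on ord0 predT G s R c ->
  (forall i, [exists v, c v == i] = odd k || (i != ord0)) ->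
  vertex_cover G T -> [set x | x != ord0] \subset c @: T.
Proof.
move=> comp used_c cov; apply/subsetP => x; rewrite inE => x0.
have : [exists v, c v == x] by rewrite used_c x0 orbT.
move=> /existsP[v /eqP cv].
have [|t tT ct] := cover_meets_class (v := v) comp cov; first by rewrite cv; apply/eqP.
by apply/imsetP; exists t; rewrite // ct.
Qed.

(** With at least [#|T|] nonzero classes, all meeting [T], the colouring is injective on [T] and
    separates the twins. *)
Lemma twins_bound (V : finType) (G : graph V) s (T : {set V}) (a b : V) k :
  vertex_cover G T -> negative_twins G s T a b -> a \in T -> b \in T -> a != b ->
  completely_colourable G s k -> k < 2 * #|T|.
Proof.
move=> cov twins aT bT ab /colourable_complete[R [c [comp used_c]]].
rewrite ltnNge; apply/negP => le_k.
have := subset_leq_card (cover_image comp used_c cov); rewrite card_nonzero => le_im.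
have kE := odd_double_half k.
apply: (injective_twins comp cov twins aT bT ab); apply/imset_injP.
by rewrite eqn_leq leq_imset_card; lia.
Qed.

(* Every edge from the class of [t] to the zero class leaves from [t], as does
   the negative loop: this takes three neighbours outside the cover. *)
Lemma alone_not_few (V : finType) (K : eqType) (o : K) (G : graph V) s R
    (c : V -> K) (T : {set V}) (z t : V) :
  complete_on o predT G s R c -> vertex_cover G T ->
  (forall t, t \in T -> c t <> o) -> c z = o -> t \in T ->
  (forall t', t' \in T -> c t' = c t -> t' = t) -> few_outside G T t -> False.
Proof.
move=> [prop loop cross] cov Tno cz tT t_only [y1 [y2 few]].
have zero_nbr x : exists v, [/\ v \notin T, adj G t v, c v = o & sgn s R t v = x].
  have [|u [u' [_ _ uu' [cu cu' sx]]]] := cross z t x isT isT.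
    by rewrite cz => /esym; exact: Tno.
  have uT : u \notin T by apply/negP => /Tno; rewrite cu cz.
  have := cov u u' uu'; rewrite (negbTE uT) /= => u'T.
  have u't := t_only u' u'T cu'; subst u'.
  by exists u; rewrite adjC cu sgnC.
have [v [vT tv cv sv]] := zero_nbr pos; have [w [wT tw cw sw]] := zero_nbr neg.
have [y [yT ty cy]] : exists y, [/\ y \notin T, adj G t y & c y <> o].
  have [u [u' [_ _ uu' cu cu']]] := loop t isT (Tno t tT).
  have outside x x' : adj G x x' -> c x = c t -> c x' = c t -> x \in T ->
      exists y, [/\ y \notin T, adj G t y & c y <> o].
    move=> xx' cx cx' xT; have xt := t_only x xT cx; subst x.
    exists x'; split=> //; last by rewrite cx'; exact: Tno.
    by apply/negP => x'T; have := adj_neq xx'; rewrite (t_only x') // eqxx.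
  have /orP[uT | u'T] := cov u u' uu'; first exact: (outside u u').
  by apply: (outside u' u); rewrite // adjC.
have vw : v <> w by move=> vw; move: sw; rewrite -vw sv.
have vy : v <> y by move=> vy; case: cy; rewrite -vy.
have wy : w <> y by move=> wy; case: cy; rewrite -wy.
have := few v vT tv; have := few w wT tw; have := few y yT ty.
by move=> [] ey [] ew [] ev; congruence.
Qed.

(** Of the [#|T|] classes one is zero, and it avoids [T], or else the colouring would be injective
    on [T]. So exactly one pair of [T] shares a class, and neither [p] nor [q] can be alone. They
    may be the twins themselves, as happens with three hubs. *)
Lemma few_share_class (V : finType) (G : graph V) s (T : {set V}) (a b p q : V) k :
  vertex_cover G T -> negative_twins G s T a b -> a \in T -> b \in T -> a != b ->
  p \in T -> q \in T -> p != q -> few_outside G T p -> few_outside G T q ->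
  k.+1 = 2 * #|T| -> completely_colourable G s k ->
  exists R (c : V -> 'I_(k./2).+1),
    [/\ complete_on ord0 predT G s R c, forall t, t \in T -> c t <> ord0,
        exists z, c z = ord0, c p = c q & {in T :\ p &, injective c}].
Proof.
move=> cov twins aT bT ab pT qT pq fp fq kT /colourable_complete[R [c [comp used_c]]].
have sub_im := cover_image comp used_c cov.
have kE := odd_double_half k; have odd_k : odd k by lia.
have Tno t : t \in T -> c t <> ord0.
  move=> tT ct; apply: (injective_twins comp cov twins aT bT ab).
  apply/imset_injP; rewrite eqn_leq leq_imset_card /=.
  apply: (@leq_trans #|[set: 'I_(k./2).+1]|); first by rewrite cardsT card_ord; lia.
  apply: subset_leq_card; apply/subsetP => x _.
  have [-> | x0] := eqVneq x ord0; first by apply/imsetP; exists t.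
  by apply: (subsetP sub_im); rewrite inE.
have [z cz] : exists z, c z = ord0.
  have : [exists v, c v == ord0] by rewrite used_c odd_k.
  by move=> /existsP[z /eqP]; exists z.
have shared t : t \in T -> few_outside G T t ->
    exists2 t', t' \in T :\ t & c t' = c t.
  move=> tT ft.
  have [// | no] := EM (exists2 t', t' \in T :\ t & c t' = c t).
  case: (alone_not_few comp cov Tno cz tT _ ft) => t' t'T ct'.
  have [// | t't] := eqVneq t' t.
  by case: no; exists t' => //; rewrite !inE t't.
have [p' p'T cp'] := shared p pT fp.
have inj_p : {in T :\ p &, injective c}.
  apply/imset_injP; rewrite eqn_leq leq_imset_card /=.
  have := cardsD1 p T; rewrite pT => cardT.
  have := subset_leq_card sub_im; rewrite card_nonzero => le_im.
  (* Removing [p] loses no class, as [p'] represents it. *)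
  have -> : c @: (T :\ p) = c @: T.
    apply/eqP; rewrite eqEsubset imsetS ?subsetDl //=.
    apply/subsetP => _ /imsetP[t tT ->].
    have [-> | tp] := eqVneq t p; last by rewrite imset_f // !inE tp.
    by rewrite -cp' imset_f.
  apply: leq_trans le_im; move: kT; rewrite cardT add1n.
  by move: #|_ :\ _| => m; lia.
exists R, c; split=> //; first by exists z.
(* By injectivity away from [p], the partner of [q] must be [p]. *)
have [q' + cq'] := shared q qT fq; rewrite !inE => /andP[q'q q'T].
have [<- // | q'p] := eqVneq q' p.
have := inj_p q' q; rewrite !inE q'p q'T eq_sym pq qT => /(_ isT isT cq') eq_q.
by rewrite eq_q eqxx in q'q.
Qed.

(** The only shared class is that of [p] and [q], so the twins, being other vertices, are alone in
    theirs. *)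
Lemma few_twins_bound (V : finType) (G : graph V) s (T : {set V}) (a b p q : V) k :
  vertex_cover G T -> negative_twins G s T a b -> a \in T -> b \in T -> a != b ->
  p \in T -> q \in T -> p != q -> few_outside G T p -> few_outside G T q ->
  [&& a != p, a != q, b != p & b != q] ->
  completely_colourable G s k -> k.+1 < 2 * #|T|.
Proof.
move=> cov twins aT bT ab pT qT pq fp fq /and4P[ap aq bp bq] col.
rewrite ltn_neqAle (twins_bound cov twins aT bT ab col) andbT.
apply/eqP => kT.
have [R [c [comp _ _ cpq inj_p]]] :=
  few_share_class cov twins aT bT ab pT qT pq fp fq kT col.
have alone t : t \in T -> t != p -> t != q ->
    forall t', t' \in T -> c t' = c t -> t' = t.
  move=> tT tp tq t' t'T ct'; have [t'p | t'p] := eqVneq t' p.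
    have := inj_p q t; rewrite !inE (eq_sym q) pq qT tp tT => /(_ isT isT) qt.
    by move: tq; rewrite qt ?eqxx // -ct' t'p cpq.
  by apply: inj_p; rewrite // !inE ?t'p ?tp.
apply: (separated_twins comp cov twins).
- by move=> cab; move: ab; rewrite (alone b bT bp bq a aT cab) eqxx.
- exact: alone.
exact: alone.
Qed.

(** * Graphs and signatures given by relations *)

Lemma set2_eq (V : finType) (u v p q : V) :
  ([set u; v] == [set p; q]) = (u == p) && (v == q) || (u == q) && (v == p).
Proof.
apply/eqP/orP => [eq_set | [] /andP[/eqP-> /eqP->] //]; last by rewrite setUC.
have : u \in [set p; q] by rewrite -eq_set set21.
have : v \in [set p; q] by rewrite -eq_set set22.
have : p \in [set u; v] by rewrite eq_set set21.
have : q \in [set u; v] by rewrite eq_set set22.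
rewrite !inE (eq_sym p) (eq_sym p v) (eq_sym q) (eq_sym q v).
by case: (u == p) (u == q) (v == p) (v == q) => [] [] [] [] //=; auto.
Qed.

Definition rel_edges (V : finType) (E : rel V) : {set {set V}} :=
  [set e | [exists u, exists v, [&& u != v, E u v & e == [set u; v]]]].

Lemma card_rel_edge (V : finType) (E : rel V) e : e \in rel_edges E -> #|e| = 2.
Proof.
rewrite inE => /existsP[u /existsP[v /and3P[uv _ /eqP->]]].
by rewrite cards2 uv.
Qed.

Definition rel_graph (V : finType) (E : rel V) : graph V :=
  Graph (@card_rel_edge V E).

Lemma adj_rel_graph (V : finType) (E : rel V) u v :
  adj (rel_graph E) u v = (u != v) && (E u v || E v u).
Proof.
rewrite /adj inE; apply/existsP/andP => [[p /existsP[q /and3P[pq Epq]]] | [uv]].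
  rewrite set2_eq => /orP[] /andP[/eqP-> /eqP->];
  by split; rewrite ?Epq ?orbT // eq_sym.
case/orP => E_uv; [exists u | exists v]; apply/existsP; [exists v | exists u].
  by rewrite uv E_uv /=.
by rewrite eq_sym uv E_uv setUC /=.
Qed.

Lemma adj_delete_rel_graph (V : finType) (E E' : rel V) (p q : V) :
  ~~ E q p -> (forall u v, E' u v = E u v && ~~ ((u == p) && (v == q))) ->
  adj (delete_edge (rel_graph E) [set p; q]) =2 adj (rel_graph E').
Proof.
move=> Eqp E'E u v.
have -> : adj (delete_edge (rel_graph E) [set p; q]) u v =
    adj (rel_graph E) u v && ([set u; v] != [set p; q]).
  by rewrite /adj in_setD1 andbC.
rewrite !adj_rel_graph !E'E set2_eq; case: (u =P v) => //= uv.
have [up|] := eqVneq u p; have [uq|] := eqVneq u q;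
  have [vp|] := eqVneq v p; have [vq|] := eqVneq v q; subst;
  rewrite ?andbT ?andbF ?orbF ?(negbTE Eqp) //=.
Qed.

Definition rel_sign (V : finType) (P : rel V) : signature V :=
  fun e => [exists u, exists v, (e == [set u; v]) && P u v].

Lemma rel_signE (V : finType) (P : rel V) u v :
  symmetric P -> rel_sign P [set u; v] = P u v.
Proof.
move=> symP; apply/existsP/idP => [[p /existsP[q]] | Puv].
  by rewrite set2_eq => /andP[/orP[] /andP[/eqP-> /eqP->] //]; rewrite symP.
by exists u; apply/existsP; exists v; rewrite eqxx.
Qed.

Lemma eq_adj_colourable (V : finType) (G G' : graph V) s k :
  adj G =2 adj G' -> completely_colourable G s k -> completely_colourable G' s k.
Proof.
move=> eqG /completely_colourable_natP[R [d [[prop loop cross] vert]]].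
apply: (iffRL (completely_colourable_natP G' s k)); exists R, d; split=> //.
split=> [u v Wu Wv | v Wv dv | v w x Wv Ww neq].
- by rewrite -eqG; exact: prop.
- by have [u [u' H]] := loop v Wv dv; exists u, u'; rewrite -eqG.
by have [u [u' H]] := cross v w x Wv Ww neq; exists u, u'; rewrite -eqG.
Qed.

Lemma eq_achromatic (V : finType) (G G' : graph V) s :
  adj G =2 adj G' -> achromatic G s = achromatic G' s.
Proof.
move=> eqG; apply: eq_bigl => k; congr (_ && _); apply/asboolP/asboolP.
  exact: eq_adj_colourable.
by apply: eq_adj_colourable => u v.
Qed.

(** * The graphs of hubs and leaves, their colourings and bounds *)

(* Besides the hubs and the leaves, there are one extra vertex and two vertices
   [inr (Some _)] meant for the class of 0. *)
Definition vtx (n : nat) : finType := ('I_n * bool + option bool)%type.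

Definition hub n (i : 'I_n) : vtx n := inl (i, true).
Definition leaf n (i : 'I_n) : vtx n := inl (i, false).
Definition extra n : vtx n := inr None.

(* [r] joins hubs to leaves, [b] tells whether the class of 0 is available, [sp]
   adds the edge between leaves 0 and 1, and [w0], [w1] those from hubs 0 and 1
   to the extra vertex. *)
Definition split_arc n (r : rel nat) (b sp w0 w1 : bool) : rel (vtx n) :=
  fun u v => match u, v with
  | inl (i, true), inl (j, true) => true
  | inl (i, true), inl (j, false) => r i j
  | inl (i, true), inr None => (i == 0 :> nat) && w0 || (i == 1 :> nat) && w1
  | inl (i, true), inr (Some _) => b
  | inl (i, false), inl (j, false) => [&& sp, i == 0 :> nat & j == 1 :> nat]
  | _, _ => false
  end.

Definition split_graph n r b sp w0 w1 : graph (vtx n) :=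
  rel_graph (split_arc r b sp w0 w1).

(** Hub edges supply the positive sign between classes, hub-leaf edges the negative one and the
    loops. Hubs 0 and 1, the twins, are joined negatively, so their positive edge must come from
    elsewhere. *)
Definition split_pos n : rel (vtx n) :=
  fun u v => match u, v with
  | inl (i, true), inl (j, true) => (1 < i) || (1 < j)
  | inl (i, false), inl (j, false) => true
  | _, _ => false
  end.

Definition split_sign n : signature (vtx n) := rel_sign (@split_pos n).

Lemma split_signE n u v : @split_sign n [set u; v] = split_pos u v.
Proof.
by apply: rel_signE => -[[i []]|[[]|]] [[j []]|[[]|]] //=; rewrite orbC.
Qed.

Lemma adj_splitE n r b sp w0 w1 (u v : vtx n) :
  adj (split_graph n r b sp w0 w1) u v =
  (u != v) && (split_arc r b sp w0 w1 u v || split_arc r b sp w0 w1 v u).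
Proof. exact: adj_rel_graph. Qed.

Definition hubs n : {set vtx n} := [set hub i | i : 'I_n].

Lemma in_hubs n (u : vtx n) :
  (u \in hubs n) = if u is inl (_, true) then true else false.
Proof.
apply/imsetP/idP => [[i _ ->] //|].
by case: u => [[i []]|] // _; exists i.
Qed.

Lemma card_hubs n : #|hubs n| = n.
Proof. by rewrite card_imset ?cardsT ?card_ord // => i j []. Qed.

Definition ord_0 n : 'I_n.+2 := @Ordinal n.+2 0 isT.
Definition ord_1 n : 'I_n.+2 := @Ordinal n.+2 1 isT.

Lemma eq_hub n (u : vtx n) i :
  (u == hub i) = if u is inl (j, true) then j == i :> nat else false.
Proof.
case: u => [[j []]|x] /=; [ | by apply/eqP | by apply/eqP].
by apply/eqP/eqP => [[->] // | /val_inj->].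
Qed.

Lemma eq_leaf n (u : vtx n) i :
  (u == leaf i) = if u is inl (j, false) then j == i :> nat else false.
Proof.
case: u => [[j []]|x] /=; [by apply/eqP | | by apply/eqP].
by apply/eqP/eqP => [[->] // | /val_inj->].
Qed.

Lemma eq_extra n (u : vtx n) : (u == extra n) = if u is inr None then true else false.
Proof. by case: u => [[j []]|[x|]] /=; apply/eqP. Qed.

Lemma delete_split_leaves n r b w0 w1 :
  adj (delete_edge (split_graph n.+2 r b true w0 w1)
         [set leaf (ord_0 n); leaf (ord_1 n)])
  =2 adj (split_graph n.+2 r b false w0 w1).
Proof.
apply: adj_delete_rel_graph => // u v; rewrite !eq_leaf.
by case: u v => [[i []]|[[]|]] [[j []]|[[]|]] //=; rewrite ?andbT ?andbN.
Qed.

Lemma delete_split_extra n r b sp w1 :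
  adj (delete_edge (split_graph n.+2 r b sp true w1)
         [set hub (ord_0 n); extra n.+2])
  =2 adj (split_graph n.+2 r b sp false w1).
Proof.
apply: adj_delete_rel_graph => // u v; rewrite eq_hub eq_extra.
case: u v => [[i []]|[[]|]] [[j []]|[[]|]] //=; rewrite ?andbF ?andbT //= ?andbT //.
by case: (nat_of_ord i =P 0) => [->|_]; rewrite ?andbT.
Qed.

(** Class [i] is formed by hub [i] and leaf [i]. Classes 0 and 1 get their positive edge from the
    two leaves, or from the extra vertex, switched in class 0, to hub 1. An edge from hub 0 to the
    extra vertex would be a positive loop. *)
Lemma split_colourable n (r : rel nat) b sp w1 :
  (forall i, r i i) ->
  (forall i j : nat, i != j -> (1 < i) || (1 < j) -> r i j || r j i) -> sp || w1 ->
  completely_colourable (split_graph n.+2 r b sp false w1) (@split_sign n.+2)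
    (2 * n.+2 + b).
Proof.
move=> r_refl r_total sp_w1.
pose c (u : vtx n.+2) : option 'I_n.+2 := match u with
  | inl (i, _) => Some i
  | inr None => Some (ord_0 n)
  (* If [b] is false these vertices are isolated and can join any class. *)
  | inr (Some _) => if b then None else Some (ord_0 n)
  end.
(* Exactly one of the two vertices meant for 0 is switched, so together they send both signs to
   every hub. *)
pose R (u : vtx n.+2) : bool := match u with
  | inl _ => false
  | inr None => true
  | inr (Some x) => x
  end.
set G := split_graph _ _ _ _ _ _; set s := @split_sign _.
have sE u v : s [set u; v] = split_pos u v := split_signE u v.
have GE u v := adj_splitE r b sp false w1 u v : adj G u v = _.
have cross_sym (k l : option 'I_n.+2) x :
    (exists u u', [/\ adj G u u', c u = k, c u' = l & sgn s R u u' = x]) ->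
    exists u u', [/\ adj G u u', c u = l, c u' = k & sgn s R u u' = x].
  by case=> u [u' [uu' cu cu' sx]]; exists u', u; rewrite adjC sgnC.
have hub_leaf (i j : 'I_n.+2) : r i j -> adj G (hub i) (leaf j).
  by move=> rij; rewrite GE /= rij eq_leaf.
have hub_hub (i j : 'I_n.+2) : i != j -> adj G (hub i) (hub j).
  by move=> ij; rewrite GE eq_hub /= andbT.
have cross_nz (i j : 'I_n.+2) x : i < j -> exists u u',
    [/\ adj G u u', c u = Some i, c u' = Some j & sgn s R u u' = x].
  move=> ij; have neq_ij : i != j :> nat by rewrite neq_ltn ij.
  have [j1 | j1] := ltnP 1 j.
    case: x.
      exists (hub i), (hub j); split=> //; first by apply: hub_hub.
      by rewrite /sgn sE /= j1 orbT.
    have /orP[rij | rji] : r i j || r j i by rewrite r_total // j1 orbT.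
      by exists (hub i), (leaf j); split; rewrite ?hub_leaf // /sgn sE.
    exists (leaf i), (hub j); split; rewrite // 1?adjC ?hub_leaf //.
    by rewrite /sgn sE.
  have i0 : i = ord_0 n by apply: val_inj => /=; lia.
  have j1' : j = ord_1 n by apply: val_inj => /=; lia.
  subst i j; case: x; last first.
    exists (hub (ord_0 n)), (hub (ord_1 n)); split=> //.
    by rewrite /sgn sE.
  case/orP: sp_w1 => [sp1 | w11].
    exists (leaf (ord_0 n)), (leaf (ord_1 n)); split=> //.
      by rewrite GE eq_leaf /= sp1.
    by rewrite /sgn sE.
  exists (extra _), (hub (ord_1 n)); split=> //.
    by rewrite GE eq_hub /= w11.
  by rewrite /sgn sE.
have cross_z j x : b -> exists u u',
    [/\ adj G u u', c u = None, c u' = Some j & sgn s R u u' = x].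
  move=> b1; exists (inr (Some x)), (hub j); split=> //.
  - by rewrite GE eq_hub /= b1.
  - by rewrite /= b1.
  by rewrite /sgn sE /=; case: x.
have comp : complete_on None predT G s R c.
  split=> [u v _ _ | v _ | v w x _ _].
  - rewrite GE /sgn sE.
    case: u v => [[i []]|[x|]] [[j []]|[y|]] //=; rewrite ?andbF ?andbT ?orbF //.
    + by move=> /eqP ij [eq_ij]; case: ij; rewrite eq_ij.
    + by move=> ->.
    + by move=> /andP[/eqP i1 _] [i0]; move: i1; rewrite i0.
    + move=> /andP[_ /orP[] /and3P[_ /eqP i0 /eqP j1]] [eq_ij]; move: i0 j1;
      by rewrite eq_ij => ->.
    + by move=> ->.
    by move=> /andP[/eqP i1 _] [i0]; move: i1; rewrite -i0.
  - case cv: (c v) => [k|] // _.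
    by exists (hub k), (leaf k); rewrite hub_leaf.
  move=> neq; suff [u [u' [uu' cu cu' sx]]] :
    exists u u', [/\ adj G u u', c u = c v, c u' = c w & sgn s R u u' = x].
    by exists u, u'.
  have none_b y : c y = None -> b by case: y => [[]|[]] //=; case: ifP.
  case cv: (c v) neq => [i|]; case cw: (c w) => [j|] //= neq.
  - have : i != j by apply/eqP => ij; case: neq; rewrite ij.
    rewrite -val_eqE neq_ltn => /orP[lt_ij | lt_ji]; first exact: cross_nz.
    by apply: cross_sym; exact: cross_nz.
  - by apply: cross_sym; apply: cross_z; apply: none_b cw.
  by apply: cross_z; apply: none_b cv.
suff <- : ncolours None predT c = 2 * n.+2 + b by exact: complete_colourable comp.
rewrite /ncolours; congr (2 * _ + nat_of_bool _).
  rewrite (_ : used _ _ _ = [set Some i | i : 'I_n.+2]).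
    by rewrite card_imset ?card_ord // => i j [].
  apply/setP => -[i|]; rewrite !inE /=.
    rewrite imset_f //; apply/existsP; exists (hub i) => /=; exact: eqxx.
  by symmetry; apply/imsetP => -[].
apply/existsP/idP => [[u /eqP] | b1]; first by case: u => [[]|[]] //=; case: ifP.
by exists (inr (Some true)); rewrite /= b1.
Qed.

Lemma split_cover n r b w0 w1 :
  vertex_cover (split_graph n r b false w0 w1) (hubs n).
Proof.
move=> u v; rewrite adj_splitE !in_hubs.
by case: u v => [[i []]|[[]|]] [[j []]|[[]|]] //=; rewrite andbF.
Qed.

Lemma split_twins n (r : rel nat) b w :
  (forall j, r 0 j = r 1 j) ->
  negative_twins (split_graph n.+2 r b false w w) (@split_sign n.+2) (hubs n.+2)
    (hub (ord_0 n)) (hub (ord_1 n)).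
Proof.
move=> r01; split=> [_|v|v]; rewrite ?split_signE // in_hubs.
  rewrite !adj_splitE !(eq_sym _ v) !eq_hub.
  by case: v => [[j []]|[x|]] //= _; rewrite ?r01 ?orbF.
by case: v => [[j []]|[x|]].
Qed.

Lemma split_bound n (r : rel nat) b w k :
  (forall j, r 0 j = r 1 j) ->
  completely_colourable (split_graph n.+2 r b false w w) (@split_sign n.+2) k ->
  k < 2 * n.+2.
Proof.
move=> r01 col; rewrite -{1}(card_hubs n.+2).
apply: (twins_bound (@split_cover _ _ _ _ _) (split_twins _ _ _ r01) _ _ _ col);
  by rewrite ?in_hubs // eq_hub.
Qed.

(* Hubs 2 and 3 have at most two neighbours that are not hubs, while any two
   hub-leaf pairs other than 0 and 1 remain joined by a negative edge. *)
Definition thin_rel : rel nat :=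
  fun i j => [|| (i != 2) && (i != 3), i == j | (i == 2) && (j == 3)].

Lemma thin_bound n w k :
  completely_colourable (split_graph n.+4 thin_rel false false w w)
    (@split_sign n.+4) k -> k.+1 < 2 * n.+4.
Proof.
move=> col; rewrite -{1}(card_hubs n.+4).
have twins := split_twins n.+2 false w (r := thin_rel) (fun=> erefl).
pose i2 : 'I_n.+4 := @Ordinal n.+4 2 isT; pose i3 : 'I_n.+4 := @Ordinal n.+4 3 isT.
apply: (few_twins_bound (p := hub i2) (q := hub i3) (@split_cover _ _ _ _ _) twins
  _ _ _ _ _ _ _ _ _ col); rewrite ?in_hubs ?eq_hub //.
- exists (leaf i2), (leaf i3) => v; rewrite in_hubs adj_splitE.
  case: v => [[j []]|[x|]] //= _ /andP[_]; rewrite orbF /thin_rel /=.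
  case/orP => /eqP jE; [left | right].
    by have -> : j = i2 by apply: val_inj.
  by have -> : j = i3 by apply: val_inj.
(* Leaf 3 is the only neighbour of hub 3 outside the hubs. *)
exists (leaf i3), (leaf i3) => v; rewrite in_hubs adj_splitE.
case: v => [[j []]|[x|]] //= _ /andP[_]; rewrite orbF /thin_rel /= orbF.
move=> /eqP jE; left.
by have -> : j = i3 by apply: val_inj.
Qed.

(* With three hubs there is no room for four special ones: here the twins 0 and 1
   are also the hubs with at most two neighbours that are not hubs. *)
Definition thick_rel : rel nat := fun i j => (1 < i) || (j < 2).

(** With five colours hubs 0 and 1 share a class, leaves 0 and 1 are forced to colour 0, and leaf 2
    into the class of hub 2 for its loop. Only hub edges, all of one sign, then join the two nonzero
    classes. *)
Lemma thick_bound k :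
  completely_colourable (split_graph 3 thick_rel false false false false)
    (@split_sign 3) k -> k < 5.
Proof.
move=> col; set G := split_graph _ _ _ _ _ _ in col; set s := @split_sign 3 in col.
have cov : vertex_cover G (hubs 3) := @split_cover _ _ _ _ _.
have twins : negative_twins G s (hubs 3) (hub (ord_0 1)) (hub (ord_1 1)).
  exact: (split_twins 1 false false (r := thick_rel) (fun=> erefl)).
pose l0 : vtx 3 := leaf (ord_0 1); pose l1 : vtx 3 := leaf (ord_1 1).
pose l2 : vtx 3 := leaf (@Ordinal 3 2 isT).
pose h0 : vtx 3 := hub (ord_0 1); pose h1 : vtx 3 := hub (ord_1 1).
pose h2 : vtx 3 := hub (@Ordinal 3 2 isT).
have hubP t : t \in hubs 3 -> [\/ t = h0, t = h1 | t = h2].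
  case/imsetP => -[[|[|[]]] i3] // _ ->; [apply: Or31 | apply: Or32 | apply: Or33];
  by rewrite /h0 /h1 /h2; congr hub; apply: val_inj.
have leafP (j : 'I_3) : [\/ leaf j = l0, leaf j = l1 | leaf j = l2].
  case: j => -[|[|[]]] // i3; [apply: Or31 | apply: Or32 | apply: Or33];
  by rewrite /l0 /l1 /l2; congr leaf; apply: val_inj.
have out01 h v : h = h0 \/ h = h1 -> v \notin hubs 3 -> adj G h v -> v = l0 \/ v = l1.
  rewrite in_hubs adj_splitE; case: v => [[j []]|[x|]] //=; last 2 first.
  - by case=> ->.
  - by case=> ->.
  move=> hE _; have [] := leafP j; rewrite /leaf => ->; [by left | by right |].
  by case: hE => ->.
have out2 v : v \notin hubs 3 -> adj G h2 v -> [\/ v = l0, v = l1 | v = l2].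
  rewrite in_hubs adj_splitE; case: v => [[j []]|[x|]] //= _ _.
  exact: leafP.
have : k < 6 := split_bound (n := 1) (r := thick_rel) (fun=> erefl) col.
rewrite ltnS leq_eqVlt => /orP[/eqP k5 | //]; rewrite k5 in col *.
have h0T : h0 \in hubs 3 by rewrite in_hubs.
have h1T : h1 \in hubs 3 by rewrite in_hubs.
have h2T : h2 \in hubs 3 by rewrite in_hubs.
have h01 : h0 != h1 by rewrite eq_hub.
have few h : h = h0 \/ h = h1 -> few_outside G (hubs 3) h.
  by move=> hE; exists l0, l1 => v; exact: out01.
have [|R [c [comp Tno [z cz] c01 inj]]] :=
  few_share_class cov twins h0T h1T h01 h0T h1T h01
    (few h0 (or_introl erefl)) (few h1 (or_intror erefl)) _ col.
  by rewrite card_hubs.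
have [prop loop cross] := comp.
have sE u v : s [set u; v] = split_pos u v := split_signE u v.
have R01 : R h0 = R h1.
  have h0h1 : adj G h0 h1 by rewrite adj_splitE h01.
  have [_] := prop h0 h1 isT isT h0h1 c01.
  by rewrite /sgn sE /=; case: (R h0) (R h1) => [] [].
have c12 : c h1 <> c h2.
  move=> /(inj h1 h2); rewrite !inE ![hub _ == h0]eq_hub h1T h2T => /(_ isT isT).
  by move/eqP; rewrite eq_hub.
have class0 t : t \in hubs 3 -> c t = c h0 -> (t = h0 \/ t = h1) /\ R t = R h0.
  move=> /hubP[] -> ; [by auto | by auto |].
  by rewrite c01 => /esym.
have class2 t : t \in hubs 3 -> c t = c h2 -> t = h2.
  by move=> /hubP[] // ->; rewrite ?c01 => /c12.
(* Edges from [h0] and [h1] to these leaves are all negative and both hubs are switched alike, so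
   two signs require two differently switched leaves. *)
have zero_leaves : c l0 = ord0 /\ c l1 = ord0.
  have nbr x : exists2 v, v = l0 \/ v = l1 & c v = ord0 /\ R v (+) R h0 = x.
    have [|u [u' [_ _ uu' [cu cu' sx]]]] := cross z h0 x isT isT.
      by rewrite cz => /esym; exact: Tno.
    rewrite cz in cu; have uT : u \notin hubs 3 by apply/negP => /Tno.
    have := cov u u' uu'; rewrite (negbTE uT) /= => u'T.
    have [u'01 Ru'] := class0 u' u'T cu'; rewrite adjC in uu'.
    have uE := out01 u' u u'01 uT uu'.
    exists u => //; split=> //; rewrite -sx /sgn sE -Ru'.
    by case: u'01 uE => -> [] ->.
  have [v vE [cv Rv]] := nbr true; have [w wE [cw Rw]] := nbr false.
  case: vE wE => vE [] wE; subst v w => //; by rewrite Rv in Rw.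
have [cl0 cl1] := zero_leaves.
have cl2 : c l2 = c h2.
  have loop_out u u' : adj G u u' -> c u = c h2 -> c u' = c h2 -> u \in hubs 3 ->
      c l2 = c h2.
    move=> uu' cu cu' uT; have uh := class2 u uT cu; subst u.
    have u'T : u' \notin hubs 3.
      by apply/negP => u'T; have := adj_neq uu'; rewrite (class2 u') // eqxx.
    have [] := out2 u' u'T uu' => eq_u'; subst u' => //.
      by case: (Tno h2 h2T); rewrite -cu'.
    by case: (Tno h2 h2T); rewrite -cu'.
  have [u [u' [_ _ uu' cu cu']]] := loop h2 isT (Tno h2 h2T).
  have /orP[uT | u'T] := cov u u' uu'; first exact: loop_out uu' cu cu' uT.
  by rewrite adjC in uu'; exact: loop_out uu' cu' cu u'T.
(* The edges from [h0] and [h1] to [h2] are positive, hence have the sign opposite to the one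
   requested. *)
have [|u [u' [_ _ uu' [cu cu' sx]]]] := cross h0 h2 (R h0 (+) R h2) isT isT.
  by rewrite c01.
have [uT | uT] := boolP (u \in hubs 3).
  have [u01 Ru] := class0 u uT cu; have [u'T | u'T] := boolP (u' \in hubs 3).
    have u'h := class2 u' u'T cu'; subst u'; move: sx; rewrite /sgn sE Ru.
    by case: u01 => ->; case: (R h0) (R h2) => [] [].
  have [] := out01 u u' u01 u'T uu' => eq_u'; subst u';
    by case: (Tno h2 h2T); rewrite -cu'.
have := cov u u' uu'; rewrite (negbTE uT) /= => u'T.
have u'h := class2 u' u'T cu'; subst u'; rewrite adjC in uu'.
have [] := out2 u uT uu' => eq_u; subst u.
- by case: (Tno h0 h0T); rewrite -cu.
- by case: (Tno h0 h0T); rewrite -cu.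
by case: c12; rewrite -c01 -cu.
Qed.

(** * Sharpness of both bounds *)

Lemma achromatic_leq (V : finType) (G : graph V) s m :
  (forall k, completely_colourable G s k -> k <= m) -> achromatic G s <= m.
Proof.
move=> bound; have [-> // | /achromatic_colourable] := posnP (achromatic G s).
exact: bound.
Qed.

(** The colouring bounds [G] from below, [bound] the smaller graph from above; as a deletion loses
    at most two, both are equalities. *)
Lemma drop_by_two n (r : rel nat) b :
  (forall i, r i i) ->
  (forall i j : nat, i != j -> (1 < i) || (1 < j) -> r i j || r j i) ->
  (forall k, completely_colourable (split_graph n.+2 r b false false false)
     (@split_sign n.+2) k -> k <= 2 * n.+1 + b) ->
  exists (V : finType) (G : graph V) (s : signature V) (e : {set V}),
    [/\ e \in edges G, achromatic G s = 2 * n.+2 + b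
      & achromatic (delete_edge G e) s = 2 * n.+1 + b].
Proof.
move=> r_refl r_total bound.
set G := split_graph n.+2 r b true false false.
set e := [set leaf (ord_0 n); leaf (ord_1 n)].
exists (vtx n.+2), G, (@split_sign n.+2), e.
have eG : e \in edges G by rewrite -/(adj G _ _) adj_splitE eq_leaf.
have /andP[+ _] := achromatic_delete_edge (@split_sign n.+2) eG.
rewrite (eq_achromatic _ (delete_split_leaves r b false false)).
have := achromatic_leq bound.
have : 2 * n.+2 + b <= achromatic G (@split_sign n.+2).
  by apply: leq_achromatic; [rewrite mulnS | exact: split_colourable].
move: (achromatic _ _) (achromatic _ _) => x y; rewrite !mulnS => *.
by split=> //; lia.
Qed.

(** Now the obstruction is in [G], where both twins see the extra vertex; deleting the edge at hub 0
    makes the colouring available. *)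
Lemma raise_by_two n (r : rel nat) b :
  (forall i, r i i) ->
  (forall i j : nat, i != j -> (1 < i) || (1 < j) -> r i j || r j i) ->
  (forall k, completely_colourable (split_graph n.+2 r b false true true)
     (@split_sign n.+2) k -> k <= 2 * n.+1 + b) ->
  exists (V : finType) (G : graph V) (s : signature V) (e : {set V}),
    [/\ e \in edges G, achromatic G s = 2 * n.+1 + b
      & achromatic (delete_edge G e) s = 2 * n.+2 + b].
Proof.
move=> r_refl r_total bound.
set G := split_graph n.+2 r b false true true.
set e := [set hub (ord_0 n); extra n.+2].
exists (vtx n.+2), G, (@split_sign n.+2), e.
have eG : e \in edges G by rewrite -/(adj G _ _) adj_splitE eq_extra.
have /andP[_] := achromatic_delete_edge (@split_sign n.+2) eG.
rewrite (eq_achromatic _ (delete_split_extra r b false true)).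
have := achromatic_leq bound; rewrite -/G.
have : 2 * n.+2 + b <=
    achromatic (split_graph n.+2 r b false false true) (@split_sign n.+2).
  by apply: leq_achromatic; [rewrite mulnS | exact: split_colourable].
move: (achromatic _ _) (achromatic _ _) => x y; rewrite !mulnS => *.
by split=> //; lia.
Qed.

Lemma thin_rel_refl i : thin_rel i i.
Proof. by rewrite /thin_rel eqxx orbT. Qed.

Lemma thin_rel_total (i j : nat) :
  i != j -> (1 < i) || (1 < j) -> thin_rel i j || thin_rel j i.
Proof.
by rewrite /thin_rel; case: i => [|[|[|[|i]]]]; case: j => [|[|[|[|j]]]].
Qed.

Theorem theorem3p6 :
  (forall (V : finType) (G : graph V) (s : signature V) (e : {set V}),
     e \in edges G ->
     achromatic G s - 2 <= achromatic (delete_edge G e) s <= achromatic G s + 2)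
  /\ (forall k : nat, 5 <= k ->
        exists (V : finType) (G : graph V) (s : signature V) (e : {set V}),
          [/\ e \in edges G, achromatic G s = k
            & achromatic (delete_edge G e) s = k - 2])
  /\ (forall k : nat, 6 <= k ->
        exists (V : finType) (G : graph V) (s : signature V) (e : {set V}),
          [/\ e \in edges G, achromatic G s = k
            & achromatic (delete_edge G e) s = k + 2]).
Proof.
split; first by move=> V G s e; exact: achromatic_delete_edge.
(* Odd values use the class of 0 and the twins alone; even values leave that class out, and the two
   thin hubs exclude one more colour. *)
have odd_bound n w k :
    completely_colourable (split_graph n.+2 thin_rel true false w w)
      (@split_sign n.+2) k -> k <= 2 * n.+1 + true.
  by move/(split_bound (r := thin_rel) (fun=> erefl)); rewrite mulnS; lia.
have even_bound n w k :
    completely_colourable (split_graph n.+4 thin_rel false false w w)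
      (@split_sign n.+4) k -> k <= 2 * n.+3 + false.
  by move/thin_bound; rewrite mulnS; lia.
split=> k le_k.
  have [odd_k | even_k] := boolP (odd k).
    have [n kE] : exists n, k = 2 * n.+2 + true by exists (k./2 - 2); lia.
    have -> : k - 2 = 2 * n.+1 + true by lia.
    rewrite kE.
    exact: drop_by_two thin_rel_refl thin_rel_total (@odd_bound n false).
  have [-> | k6] := eqVneq k 6.
    apply: (@drop_by_two 1 thick_rel false).
    - by move=> i; rewrite /thick_rel; case: ltnP.
    - by move=> i j _; rewrite /thick_rel => /orP[] ->; rewrite ?orbT.
    by move=> j /thick_bound.
  have [n kE] : exists n, k = 2 * n.+4 + false by exists (k./2 - 4); lia.
  have -> : k - 2 = 2 * n.+3 + false by lia.
  by rewrite kE; exact: drop_by_two thin_rel_refl thin_rel_total (@even_bound n false).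
have [odd_k | even_k] := boolP (odd k).
  have [n kE] : exists n, k = 2 * n.+1 + true by exists (k./2 - 1); lia.
  have -> : k + 2 = 2 * n.+2 + true by lia.
  by rewrite kE; exact: raise_by_two thin_rel_refl thin_rel_total (@odd_bound n true).
(* The graph after deletion reaches [k + 2 >= 8], so there are at least four hubs and no separate
   small case. *)
have [n kE] : exists n, k = 2 * n.+3 + false by exists (k./2 - 3); lia.
have -> : k + 2 = 2 * n.+4 + false by lia.
by rewrite kE; exact: raise_by_two thin_rel_refl thin_rel_total (@even_bound n true).
Qed.
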